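(* Let $(k_N)_{N\in\mathbb N}$ be a non-decreasing sequence of positive integers with $k_N\le N$, $k_N\to\infty$ and $k_N=O(\sqrt N)$. Let $A_N$ be drawn from the $N\times N$ $(k_N,0)$-checkerboard ensemble, independently for each $N$, let $Z_N$ be the $N\times N$ matrix with $(Z_N)_{ij}=F_n$ if $i\equiv j\equiv n\pmod{k_N}$, $1\le n\le k_N$, and $0$ otherwise, and set $M_N=A_N+k_NZ_N$. Then for every $\epsilon>0$: almost surely $M_N$ has $N-k_N$ eigenvalues of magnitude $O(N^{1/2+\epsilon})$ as $N\to\infty$; and for every $n\in\mathbb N$, almost surely $M_N$ has one eigenvalue of the form $NF_n+O(N^{1/2+\epsilon})$ as $N\to\infty$.
   Context: For $N\in\mathbb N$ and $k_N\le N$, the $N\times N$ $(k_N,0)$-checkerboard ensemble consists of real symmetric matrices $M=(m_{ij})$ with $m_{ij}=0$ if $i\equiv j\pmod{k_N}$ and $m_{ij}=a_{ij}$ otherwise, where $a_{ij}=a_{ji}$ ($i<j$) are i.i.d. real random variables with mean $0$, variance $1$ and finite moments of all orders. $F_n$ denotes the Fibonacci numbers with $F_1=1$, $F_2=2$, $F_{n+1}=F_n+F_{n-1}$. *)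

(* Defs.v *)
From HB Require Import structures.
From mathcomp Require Import all_boot all_order all_algebra.
From mathcomp Require Import all_classical all_reals all_analysis.
Set Implicit Arguments. Unset Strict Implicit. Unset Printing Implicit Defensive.
Import Order.TTheory GRing.Theory Num.Theory.
Local Open Scope classical_set_scope.
Local Open Scope ring_scope.

(* Fibonacci numbers with the paper's convention F_1 = 1, F_2 = 2,
   F_{n+1} = F_n + F_{n-1}.  (fibF 0 = 1 is an auxiliary value.) *)
Fixpoint fibF (n : nat) : nat :=
  match n with
  | 0 => 1
  | 1 => 1
  | (m.+1 as p).+1 => fibF p + fibF m
  end.

(* Indices are 0-based (i : 'I_N stands for the paper's index i+1);
   congruences mod k are unaffected by the shift. *)

Definition checkerboard (R : nzRingType) (k N : nat) (a : nat -> nat -> R) : 'M[R]_N :=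
  \matrix_(i < N, j < N)
    if (i %% k == j %% k)%N then 0 else a (minn i j) (maxn i j).

(* Z_N: (Z_N)_ij = F_n if i = j = n mod k with 1 <= n <= k, and 0 otherwise.
   For the 1-based index i+1, the representative n in {1..k} is (i %% k).+1. *)
Definition Zmat (R : nzRingType) (k N : nat) : 'M[R]_N :=
  \matrix_(i < N, j < N)
    if (i %% k == j %% k)%N then (fibF (i %% k).+1)%:R else 0.

Definition Mmat (R : nzRingType) (k N : nat) (a : nat -> nat -> R) : 'M[R]_N :=
  checkerboard k N a + (k%:R) *: Zmat R k N.

(* M has (at least) m eigenvalues, counted with algebraic multiplicity,
   lying in the set S: there is a multiset s of m reals in S such that
   prod_{x in s} (X - x) divides the characteristic polynomial of M. *)
Definition has_eigs_in (R : fieldType) (n : nat) (M : 'M[R]_n) (m : nat)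
    (S : set R) : Prop :=
  exists s : seq R,
    [/\ size s = m, (forall x, x \in s -> S x)
      & (\prod_(x <- s) ('X - x%:P)) %| char_poly M].

Definition is_eigenvalue (R : fieldType) (n : nat) (M : 'M[R]_n) (l : R) : Prop :=
  root (char_poly M) l.

Definition valid_idx (t : nat * nat * nat) : bool :=
  let: (N, i, j) := t in (i < j < N)%N.

Definition mutually_independent {d} {T : measurableType d} {R : realType}
    (P : probability T R) (X : nat * nat * nat -> T -> R) : Prop :=
  forall (s : seq (nat * nat * nat)) (B : nat * nat * nat -> set R),
    uniq s -> all valid_idx s -> (forall t, measurable (B t)) ->
    P (\big[setI/setT]_(t <- s) (X t @^-1` B t)) =
    (\prod_(t <- s) P (X t @^-1` B t))%E.

Definition same_law {d} {T : measurableType d} {R : realType}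
    (P : probability T R) (X Y : T -> R) : Prop :=
  forall B : set R, measurable B -> P (X @^-1` B) = P (Y @^-1` B).

(* Main.v *)
(* A_N = O(N^(1/2+eps)) in operator norm, almost surely.  By the moment method
   E tr(A_N^2m) is a sum over walks of length 2m; independence and centering
   kill every walk that uses some edge exactly once, and a walk whose edges are
   all repeated visits at most m+1 vertices, so only O(N^(m+1)) walks
   contribute, each boundedly.  Hence the sum over N of
   E tr(A_N^2m) / N^(m+3) is finite, so tr(A_N^2m) = O(N^(m+3)) almost surely,
   and it remains to take m >= 3 / (2 eps).

   Given this norm bound rho for A_N, the claims on M_N = A_N + k_N Z_N follow
   from the spectral theorem.  As k_N Z_N has rank at most k_N, the span of the
   eigenvectors of M_N with eigenvalue beyond rho meets its kernel trivially
   and has dimension at most k_N.  The indicator vector of a residue class is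
   an eigenvector of k_N Z_N with eigenvalue N F_n + O(k_N F_n), hence an
   approximate eigenvector of M_N. *)

Require Import Defs.
From HB Require Import structures.
From mathcomp Require Import all_boot all_order all_algebra.
From mathcomp Require Import all_classical all_reals all_analysis.
From mathcomp Require Import complex finmap measurable_realfun zify ring lra.
Import Order.TTheory GRing.Theory Num.Theory.
Set Implicit Arguments. Unset Strict Implicit. Unset Printing Implicit Defensive.
Local Open Scope ring_scope.

(** * Walks *)

Section Walks.

Fixpoint steps (V : Type) (x : V) (t : seq V) : seq (V * V) :=
  if t is y :: t' then (x, y) :: steps y t' else [::].

Lemma size_steps (V : Type) (x : V) (t : seq V) : size (steps x t) = size t.
Proof. by elim: t x => //= y t IH x; rewrite IH. Qed.

Lemma big_tupleS (W : nmodType) (V : finType) L (F : L.+1.-tuple V -> W) :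
  \sum_t F t = \sum_x \sum_(t : L.-tuple V) F [tuple of x :: t].
Proof.
rewrite pair_bigA/= (reindex (fun p : V * L.-tuple V => [tuple of p.1 :: p.2]))//=.
exists (fun t => (thead t, [tuple of behead t])) => [[x t] _|t _] /=.
  by congr (_, _); apply: val_inj.
by rewrite [RHS]tuple_eta.
Qed.

Lemma mx_exp_walks (R : pzSemiRingType) n (A : 'M[R]_n) L i j :
  (A ^+ L) i j =
  \sum_(t : L.-tuple 'I_n | last i t == j) \prod_(e <- steps i t) A e.1 e.2.
Proof.
elim: L i => [|L IH] i.
  rewrite expr0 mxE big_mkcond (big_pred1 [tuple])/=; last first.
    by move=> t; rewrite (tuple0 t) /= eqxx.
  by case: eqP; rewrite ?big_nil.
rewrite exprS mxE [RHS]big_mkcond big_tupleS/=; apply: eq_bigr => l _.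
rewrite IH big_distrr [LHS]big_mkcond/=; apply: eq_bigr => t _.
by case: eqP; rewrite ?big_cons.
Qed.

(** A connected graph has at most one vertex more than edges. If prepending [x] brings a new vertex,
    the step leaving [x] has a new key: an old step with that key would have [x] as an endpoint,
    putting [x] on the walk already. *)
Lemma size_undup_steps (V K : eqType) (key : V * V -> K) (x : V) (t : seq V) :
  (forall e e', key e = key e' -> (e.1 == e'.1) || (e.1 == e'.2)) ->
  (size (undup (x :: t)) <= (size (undup (map key (steps x t)))).+1)%N.
Proof.
move=> keyP; elim: t x => [//|y t IH] x.
have memsteps z w e : e \in steps z w -> (e.1 \in z :: w) && (e.2 \in z :: w).
  elim: w z => [//|a w IHw] z /=; rewrite inE => /orP[/eqP->|/IHw/andP[e1 e2]].
    by rewrite !inE !eqxx !orbT.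
  by rewrite !(in_cons z) e1 e2 !orbT.
have undup_cons (W : eqType) (a : W) s :
  undup (a :: s) = if a \in s then undup s else a :: undup s by [].
have -> : steps x (y :: t) = (x, y) :: steps y t by [].
rewrite map_cons (undup_cons _ x) (undup_cons _ (key _)).
case: ifPn => [xin|xnin].
  by apply: (leq_trans (IH y)); rewrite ltnS; case: ifP => // _; exact: leqW.
case: ifPn => [|_].
  case/mapP => e es /keyP /orP[]/eqP/= xe.
  - by have /andP[] := memsteps _ _ _ _ es; rewrite -xe (negPf xnin).
  - by have /andP[] := memsteps _ _ _ _ es; rewrite -xe (negPf xnin).
by rewrite ltnS; exact: IH.
Qed.

Lemma size_undup_repeated (K : eqType) (s : seq K) :
  (forall x, x \in s -> 1 < count_mem x s)%N -> (2 * size (undup s) <= size s)%N.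
Proof.
move=> H; rewrite -[leqRHS]sum1_size -big_undup_iterop_count.
rewrite -[size (undup s)]sum1_size big_distrr/= big_seq [leqRHS]big_seq.
apply: leq_sum => x; rewrite mem_undup => /H; rewrite Monoid.iteropE.
move=> h; rewrite /= iter_addn. rewrite mul1n addn0 muln1. done.
Qed.

(** Such a walk is determined by a list of [q.+1] vertices and a word of [L.+1] positions in that
    list; [f] decodes these data and reaches every walk counted. *)
Lemma card_few_values (V : finType) L q :
  (#|[set p : V * L.-tuple V | (size (undup (p.1 :: p.2)) <= q.+1)%N]| <=
   q.+1 ^ L.+1 * #|V| ^ q.+1)%N.
Proof.
pose f (z : q.+1.-tuple V * ('I_q.+1 * L.-tuple 'I_q.+1)) : V * L.-tuple V :=
  (tnth z.1 z.2.1, [tuple of map (tnth z.1) z.2.2]).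
have -> : (q.+1 ^ L.+1 * #|V| ^ q.+1 =
   #|{: q.+1.-tuple V * ('I_q.+1 * L.-tuple 'I_q.+1)}|)%N.
  by rewrite !card_prod !card_tuple card_ord -expnS mulnC.
rewrite -cardsT; apply: leq_trans (leq_imset_card f _); apply: subset_leq_card.
apply/fintype.subsetP => -[x t]; rewrite inE /= => sz.
set s := undup (x :: t) in sz.
(* Padding with copies of [x] brings the list of distinct vertices to length exactly [q.+1]. *)
have szu : size (take q.+1 (s ++ nseq q.+1 x)) == q.+1.
  by rewrite size_takel// size_cat size_nseq leq_addl.
pose u := Tuple szu.
have uE y : y \in x :: t -> tnth u (inord (index y s)) = y.
  move=> yxt; have ys : y \in s by rewrite mem_undup.
  have is_ : (index y s < size s)%N by rewrite index_mem.
  have iq := leq_trans is_ sz.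
  by rewrite (tnth_nth x) inordK//= nth_take// nth_cat is_ nth_index.
apply/imsetP; exists (u, (inord (index x s), [tuple of map (fun y => inord (index y s)) t])) => //.
rewrite /f /=; congr (_, _); first by rewrite uE// mem_head.
apply: val_inj => /=; rewrite -map_comp -[LHS]map_id.
by apply/eq_in_map => y yt /=; rewrite uE// inE yt orbT.
Qed.

End Walks.

Local Open Scope classical_set_scope.
Local Open Scope ring_scope.

(** * Perturbation of symmetric matrices *)

Lemma char_poly_similar (F : comNzRingType) n (V D U : 'M[F]_n) :
  V *m U = 1%:M -> char_poly (V *m D *m U) = char_poly D.
Proof.
move=> VU; rewrite /char_poly /char_poly_mx.
have VU' : map_mx polyC V *m map_mx polyC U = 1%:M.
  by rewrite -map_mxM VU map_mx1.
have -> : 'X%:M - map_mx polyC (V *m D *m U) =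
    map_mx polyC V *m ('X%:M - map_mx polyC D) *m map_mx polyC U.
  by rewrite mulmxBr mulmxBl scalar_mxC -(mulmxA 'X%:M) VU' mulmx1 !map_mxM.
by rewrite !det_mulmx mulrAC -det_mulmx VU' det1 mul1r.
Qed.

Section Spectral.
Local Open Scope sesquilinear_scope.
Local Open Scope complex_scope.
Variable R : realType.
Local Notation C := (R[i]).
Local Notation toC := (map_mx (real_complex R)).

(** The squared Euclidean norm, kept in [C] so that it equals an entry of [v *m v^t*] without a
    cast. *)
Definition sqn n (v : 'rV[C]_n) : C := \sum_j `|v 0 j| ^+ 2.

Lemma sqnE n (v : 'rV[C]_n) : sqn v = (v *m v^t*) 0 0.
Proof. by rewrite mxE; apply: eq_bigr => j _; rewrite !mxE normCK. Qed.

Lemma sqn_unitary n (v : 'rV[C]_n) (P : 'M[C]_n) :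
  P \is unitarymx -> sqn (v *m P) = sqn v.
Proof.
move=> /unitarymxP PP.
by rewrite !sqnE trmx_mul map_mxM mulmxA -(mulmxA v) PP mulmx1.
Qed.

(** A real symmetric matrix is Hermitian over [C], hence unitarily diagonalizable with real
    spectrum; so [d] can be taken over [R]. *)
Lemma sym_spectral n (S : 'M[R]_n) : S^T = S ->
  exists (P : 'M[C]_n) (d : 'rV[R]_n), [/\ P \is unitarymx, P^t* \is unitarymx,
    P^t* *m P = 1%:M & toC S = P^t* *m diag_mx (toC d) *m P].
Proof.
move=> symS.
have herm : toC S \is hermsymmx.
  apply: realsym_hermsym.
    by apply/is_hermitianmxP; rewrite expr0 scale1r map_mx_id// map_trmx symS.
  by apply/mxOverP => i j; rewrite mxE complex_real.
have /orthomx_spectralP := hermitian_normalmx herm.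
have := hermitian_spectral_diag_real herm.
have := spectral_unitarymx (toC S).
set P := spectralmx _; set d := spectral_diag _ => Pu /mxOverP dr.
rewrite invmx_unitary// => E.
exists P, (map_mx (@complex.Re R) d); split=> //.
- by rewrite trmxC_unitary.
- by rewrite -invmx_unitary// mulVmx// unitarymx_unit.
rewrite E; congr (_ *m diag_mx _ *m _).
by apply/rowP => j; rewrite !mxE RRe_real//.
Qed.

Lemma spectral_char_poly n (S : 'M[R]_n) (P : 'M[C]_n) (d : 'rV[R]_n) :
  P^t* *m P = 1%:M -> toC S = P^t* *m diag_mx (toC d) *m P ->
  char_poly S = \prod_i ('X - (d 0 i)%:P).
Proof.
move=> PP E; apply: (map_inj_poly (@complexI R) (rmorph0 _)).
rewrite map_char_poly E char_poly_similar// char_poly_trig; last first.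
  exact: diag_mx_is_trig.
rewrite rmorph_prod; apply: eq_bigr => i _ /=.
by rewrite map_polyXsubC !mxE eqxx mulr1n.
Qed.

Lemma spectral_trace n (S : 'M[R]_n) (P : 'M[C]_n) (d : 'rV[R]_n) p :
  P *m P^t* = 1%:M -> P^t* *m P = 1%:M -> toC S = P^t* *m diag_mx (toC d) *m P ->
  \tr (S ^+ p) = \sum_i d 0 i ^+ p.
Proof.
move=> PP PP' E; apply: (@complexI R); rewrite -trace_map_mx.
have -> : toC (S ^+ p) = P^t* *m diag_mx (toC (map_mx (fun x => x ^+ p) d)) *m P.
  elim: p => [|p IH].
    rewrite expr0 map_mx1 (_ : diag_mx _ = 1%:M) ?mulmx1//.
    rewrite -diag_const_mx; congr diag_mx.
    by apply/rowP => j; rewrite !mxE expr0.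
  rewrite exprSr map_mxM IH E !mulmxA -(mulmxA _ P) PP mulmx1.
  rewrite -(mulmxA _ (diag_mx _) (diag_mx _)) mulmx_diag; congr (_ *m diag_mx _ *m _).
  by apply/rowP => j; rewrite !mxE -rmorphM exprSr.
rewrite mxtrace_mulC mulmxA PP mul1mx mxtrace_diag rmorph_sum.
by apply: eq_bigr => i _; rewrite !mxE.
Qed.

Lemma normC_sqr_real (x : R) : `|x%:C| ^+ 2 = (x ^+ 2)%:C.
Proof. by rewrite normc_def /= expr0n addr0 sqrtr_sqr -rmorphXn /= real_normK// num_real. Qed.

(** The trace is a sum of even powers of real eigenvalues, so each single term is below it and every
    eigenvalue has modulus at most [rho]. *)
Lemma sym_sqn_le n (A : 'M[R]_n) m (rho : R) : A^T = A -> (0 < m)%N ->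
  0 <= rho -> \tr (A ^+ (2 * m)) <= rho ^+ (2 * m) ->
  forall v : 'rV[C]_n, sqn (v *m toC A) <= (rho ^+ 2)%:C * sqn v.
Proof.
move=> symA m0 rho0 trA v.
have [P [d [Pu Pu' PP E]]] := sym_spectral symA.
move: trA; rewrite (spectral_trace _ _ PP E); last exact/unitarymxP.
move=> trA.
have dle i : d 0 i ^+ 2 <= rho ^+ 2.
  rewrite -(@ler_pXn2r _ m)// ?nnegrE ?sqr_ge0// -!exprM.
  apply: le_trans trA; rewrite (bigD1 i)//= lerDl.
  by apply: sumr_ge0 => j _; rewrite exprM exprn_ge0// sqr_ge0.
rewrite E !mulmxA sqn_unitary// -(sqn_unitary v Pu') /sqn mulr_sumr.
apply: ler_sum => i _.
rewrite mul_mx_diag mxE [toC d 0 i]mxE normrM exprMn mulrC.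
by rewrite ler_wpM2r ?exprn_ge0// normC_sqr_real lecR.
Qed.

(** In the eigenbasis, [M - mu] multiplies the coordinate [w 0 i] by [d 0 i - mu]. If only factors
    of modulus above [rho] meet nonzero coordinates, a nonzero [v] would be stretched by more than
    [rho]. *)
Lemma far_spectrum_sqn n (M : 'M[R]_n) (P : 'M[C]_n) (d : 'rV[R]_n) (mu rho : R)
    (v : 'rV[C]_n) :
  P \is unitarymx -> P^t* \is unitarymx -> P^t* *m P = 1%:M ->
  toC M = P^t* *m diag_mx (toC d) *m P -> 0 <= rho ->
  sqn (v *m toC M - mu%:C *: v) <= (rho ^+ 2)%:C * sqn v ->
  (forall i, (v *m P^t*) 0 i = 0 \/ rho < `|d 0 i - mu|) -> v = 0.
Proof.
move=> Pu Pu' PP E rho0.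
set w := v *m P^t* => + far.
have vw : v = w *m P by rewrite /w -mulmxA PP mulmx1.
have sv : sqn v = sqn w by rewrite /w sqn_unitary.
rewrite (_ : v *m toC M - mu%:C *: v =
    \row_i (w 0 i * (d 0 i - mu)%:C) *m P); last first.
  rewrite E !mulmxA -/w {1}vw scalemxAl -mulmxBl; congr (_ *m _).
  apply/rowP => i; rewrite mul_mx_diag !mxE rmorphB/= mulrBr.
  by congr (_ - _); rewrite mulrC.
rewrite sqn_unitary// sv -subr_le0 /sqn mulr_sumr -sumrB.
under eq_bigr do rewrite mxE normrM exprMn normC_sqr_real mulrC -mulrBl -rmorphB.
(* These terms are all nonnegative while their sum is at most 0, so each of them vanishes. *)
pose F i := ((d 0 i - mu) ^+ 2 - rho ^+ 2)%:C * `|w 0 i| ^+ 2.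
rewrite -/(\sum_i F i) => Fle.
have F0 i : 0 <= F i.
  rewrite /F; have [->|fi] := far i; first by rewrite normr0 expr0n mulr0.
  rewrite mulr_ge0 ?exprn_ge0// ler0c subr_ge0 -[leRHS]real_normK ?num_real//.
  by rewrite lerXn2r ?nnegrE// ltW.
have /eqP : \sum_i F i = 0.
  by apply/eqP; rewrite eq_le Fle sumr_ge0.
rewrite psumr_eq0// => /allP w0; rewrite vw (_ : w = 0) ?mul0mx//.
apply/rowP => i; rewrite [RHS]mxE; have [//|fi] := far i.
have := w0 i (mem_index_enum _); rewrite /F /= mulf_eq0 => /orP[|].
  rewrite (inj_eq (@complexI R)) subr_eq0 -[X in X == _]real_normK ?num_real//.
  by rewrite eqrXn2// => /eqP fE; move: fi; rewrite fE ltxx.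
by rewrite expf_eq0/= normr_eq0 => /eqP.
Qed.

(** Since [v] is an eigenvector of [B], the residual of [v] for [A + B] at [mu] is [v *m A], of norm
    at most [rho] times that of [v]; a spectrum entirely farther than [rho] from [mu] would force
    [v = 0]. *)
Lemma exists_close_eigenvalue n (A B : 'M[R]_n) (rho mu : R) (v : 'rV[R]_n) :
  (A + B)^T = A + B -> 0 <= rho ->
  (forall v : 'rV[C]_n, sqn (v *m toC A) <= (rho ^+ 2)%:C * sqn v) ->
  v != 0 -> v *m B = mu *: v ->
  exists l, is_eigenvalue (A + B) l /\ `|l - mu| <= rho.
Proof.
move=> symM rho0 Ale v0 vB.
have [P [d [Pu Pu' PP E]]] := sym_spectral symM.
apply: contrapT => H.
have far i : rho < `|d 0 i - mu|.
  rewrite ltNge; apply/negP => di; apply: H; exists (d 0 i); split=> //.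
  rewrite /is_eigenvalue (spectral_char_poly PP E) -(big_map (fun i => d 0 i) xpredT (fun x => 'X - x%:P)) root_prod_XsubC.
  by apply: (map_f (fun i => d 0 i)); rewrite mem_index_enum.
have : toC v = 0.
  apply: (far_spectrum_sqn (mu := mu) Pu Pu' PP E rho0) => [|i]; last by right.
  rewrite map_mxD mulmxDr -(map_mxM _ v B) vB map_mxZ addrK; exact: Ale.
move/matrixP => H0; move/eqP: v0; apply; apply/matrixP => i j.
by have := H0 i j; rewrite !mxE => /(@complexI R).
Qed.

Lemma has_small_eigs n (A B : 'M[R]_n) (rho : R) k :
  (A + B)^T = A + B -> 0 <= rho ->
  (forall v : 'rV[C]_n, sqn (v *m toC A) <= (rho ^+ 2)%:C * sqn v) ->
  (\rank B <= k)%N ->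
  has_eigs_in (A + B) (n - k) [set x | `|x| <= rho].
Proof.
move=> symM rho0 Ale rB.
have [P [d [Pu Pu' PP E]]] := sym_spectral symM.
pose J := [set i | rho < `|d 0 i|]%SET.
have Jk : (#|J| <= k)%N.
  rewrite leqNgt; apply/negP => kJ.
  (* The rows of [W] are the eigenvectors whose eigenvalue exceeds [rho] in modulus. *)
  pose W : 'M[C]_(#|J|, n) := rowsub (@enum_val _ (mem J)) P.
  have WP : W *m P^t* = rowsub (@enum_val _ (mem J)) 1%:M.
    by rewrite mul_rowsub_mx; have /unitarymxP-> := Pu.
  have Wfree : row_free W.
    apply/row_freeP; exists (colsub (@enum_val _ (mem J)) (P ^t* )).
    have /unitarymxP PPu := Pu.
    rewrite (_ : _ *m _ = mxsub (@enum_val _ (mem J)) (@enum_val _ (mem J)) (P *m P ^t* )).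
      rewrite PPu; apply/matrixP => i j; rewrite !mxE.
      by rewrite (inj_eq enum_val_inj).
    by apply/matrixP => i j; rewrite !mxE; apply: eq_bigr => l _; rewrite !mxE.
  (* There are more than [k] rows and [B] has rank at most [k], so some nontrivial combination of
     them is killed by [B]. On it [A + B] acts as [A], contradicting the lower bound on the
     stretch. *)
  have : kermx (W *m toC B) != 0.
    rewrite kermx_eq0 /row_free neq_ltn; apply/orP; left.
    apply: leq_ltn_trans kJ; apply: leq_trans (mxrankM_maxr _ _) _.
    by rewrite mxrank_map.
  case/rowV0Pn => c /sub_kermxP cWB c0.
  have : c *m W = 0.
    apply: (far_spectrum_sqn (mu := 0) Pu Pu' PP E rho0) => [|i].
      rewrite scale0r subr0 map_mxD mulmxDr -(mulmxA c W (toC B)) cWB addr0.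
      exact: Ale.
    rewrite subr0; have [iJ|iJ] := boolP (i \in J).
      by right; rewrite inE in iJ.
    left; rewrite -mulmxA WP mxE big1// => j _; rewrite !mxE.
    case: eqP => [ij|]; last by rewrite mulr0.
    by move: iJ; rewrite -ij enum_valP.
  move/eqP; rewrite mulmx_free_eq0//; exact/negP.
(* The list may be longer than [n - k]; [take] cuts it to the exact size, and the dropped factors
   remain in the quotient of the characteristic polynomial. *)
pose s := [seq d 0 i | i <- enum (~: J)].
have ss : (n - k <= size s)%N.
  rewrite size_map -cardE.
  by have := cardsC J; rewrite card_ord; lia.
exists (take (n - k) s); split.
- by rewrite size_takel.
- move=> x /mem_take; rewrite /s => xs; case/mapP: xs => i; rewrite mem_enum !inE -leNgt => di ->.
  exact: di.
rewrite (spectral_char_poly PP E) (bigID (mem J))/= dvdp_mull//.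
have -> : \prod_(i | i \notin J) ('X - (d 0 i)%:P) = \prod_(x <- s) ('X - x%:P).
  rewrite /s big_map big_enum/=; by apply: eq_bigl => i; rewrite !inE.
by rewrite -{2}(cat_take_drop (n - k) s) big_cat/= dvdp_mulr.
Qed.

End Spectral.

(** * Expectation of products of independent variables *)

Section Independence.
Context (d : measure_display) (T : measurableType d) (R : realType)
  (P : probability T R).

Import HBNNSimple.

(** The hypothesis is the case where [g] is an indicator. Linearity extends it to simple functions
    and monotone convergence to nonnegative measurable ones. *)
Lemma integral_mul_comp (X : {RV P >-> R}) (W : T -> R) (c : R) :
  measurable_fun setT W -> (forall x, 0 <= W x) -> 0 <= c ->
  (forall B, measurable B ->
    (\int[P]_x (W x * \1_(X @^-1` B) x)%:E = c%:E * P (X @^-1` B))%E) ->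
  forall g : R -> R, measurable_fun setT g -> (forall r, 0 <= g r) ->
    (\int[P]_x (W x * g (X x))%:E = c%:E * \int[P]_x (g (X x))%:E)%E.
Proof.
move=> mW W0 c0 HB g mg g0.
pose gE (r : R) := (g r)%:E.
have mg' : measurable_fun setT gE by exact/measurable_EFinP.
have g0' x : setT x -> (0 <= gE x)%E by rewrite lee_fin.
pose h := nnsfun_approx measurableT mg'.
have mX : measurable_fun setT X by [].
have mhX n : measurable_fun setT (fun x => h n (X x)).
  exact: (measurableT_comp (measurable_funP (h n)) mX).
have hlim r : (h n r)%:E @[n --> \oo] --> gE r.
  exact: (cvg_nnsfun_approx measurableT mg' g0' (x := r)).
have hnd r a b : (a <= b)%N -> h a r <= h b r.
  by move=> ab; exact/lefP/nd_nnsfun_approx.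
have cvgR : (\int[P]_x (h n (X x))%:E @[n --> \oo] --> \int[P]_x gE (X x))%E.
  have -> : (\int[P]_x gE (X x) = \int[P]_x (limn (fun n => (h n (X x))%:E)))%E.
    by apply: eq_integral => x _; apply/esym/cvg_lim.
  apply: cvg_monotone_convergence => //=.
  - by move=> n; apply/measurable_EFinP.
  - by move=> n x _; rewrite lee_fin.
  - by move=> x _ a b ab; rewrite lee_fin hnd.
have cvgL : (\int[P]_x (W x * h n (X x))%:E @[n --> \oo] -->
    \int[P]_x (W x * g (X x))%:E)%E.
  have -> : (\int[P]_x (W x * g (X x))%:E =
      \int[P]_x (limn (fun n => (W x * h n (X x))%:E)))%E.
    apply: eq_integral => x _; apply/esym/cvg_lim => //.
    under eq_fun do rewrite EFinM.
    rewrite EFinM; apply: cvgeZl => //; exact: hlim.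
  apply: cvg_monotone_convergence => //=.
  - by move=> n; apply/measurable_EFinP/measurable_funM.
  - by move=> n x _; rewrite lee_fin mulr_ge0.
  - by move=> x _ a b ab; rewrite lee_fin ler_wpM2l// hnd.
suff suf n : (\int[P]_x (W x * h n (X x))%:E = c%:E * \int[P]_x (h n (X x))%:E)%E.
  have cvgR' := cvgeZl (isT : c%:E \is a fin_num) cvgR.
  rewrite (eq_cvg _ _ suf) in cvgL.
  exact: (cvg_unique _ cvgL cvgR').
pose E y := X @^-1` (h n @^-1` [set y]).
have mE y : measurable (E y).
  by rewrite -[E y]setTI; apply: mX => //; exact: measurable_sfunP.
pose s : seq R := fset_set (range (h n)).
(* Values of [h n] are nonnegative, so the absolute value changes nothing; it makes each summand
   nonnegative for every [y], as exchanging sum and integral demands. *)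
have hE x : h n (X x) = \sum_(y <- s) (`|y| * \1_(E y) x).
  rewrite {1}fimfunE fsbig_finite//= big_seq [RHS]big_seq.
  apply: eq_bigr => y; rewrite in_fset_set// => /set_mem[r _ <-].
  by rewrite ger0_norm// !indicE.
have mI y : measurable_fun setT (fun x => \1_(E y) x : R).
  exact: measurable_indic.
under eq_integral do rewrite hE mulr_sumr -sumEFin.
under [in RHS]eq_integral do rewrite hE -sumEFin.
have m1 y : measurable_fun setT (fun x => (`|y| * \1_(E y) x)%:E).
  by apply/measurable_EFinP/measurable_funM.
have m2 y : measurable_fun setT (fun x => (W x * (`|y| * \1_(E y) x))%:E).
  by apply/measurable_EFinP/measurable_funM => //; apply: measurable_funM.
have p1 y x : setT x -> (0 <= (`|y| * \1_(E y) x)%:E)%E.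
  by rewrite lee_fin mulr_ge0.
have p2 y x : setT x -> (0 <= (W x * (`|y| * \1_(E y) x))%:E)%E.
  by rewrite lee_fin !mulr_ge0.
rewrite (ge0_integral_sum _ measurableT m2 p2) (ge0_integral_sum _ measurableT m1 p1).
rewrite ge0_sume_distrr; last first.
  by move=> y _; apply: integral_ge0 => x _; rewrite lee_fin mulr_ge0.
apply: eq_bigr => y _.
under eq_integral do rewrite mulrCA EFinM.
under [in RHS]eq_integral do rewrite EFinM.
rewrite !ge0_integralZl_EFin//.
- rewrite integral_indic// setIT HB; first by rewrite muleCA.
  exact: measurable_sfunP.
- exact/measurable_EFinP.
- by move=> x _; rewrite lee_fin mulr_ge0.
- by apply/measurable_EFinP/measurable_funM.
Qed.


Local Notation idx := (nat * nat * nat)%type.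
Variable a : idx -> {RV P >-> R}.
Hypothesis indep : mutually_independent P (fun t => (a t : T -> R)).

Lemma measurable_bigI (s : seq idx) (B : idx -> set R) :
  (forall t, measurable (B t)) ->
  measurable (\big[setI/setT]_(t <- s) (a t @^-1` B t)).
Proof.
move=> mB; apply: bigsetI_measurable => t _.
by rewrite -[X in measurable X]setTI; apply: measurable_funP.
Qed.

Lemma measurable_prod_comp (s : seq idx) (f : idx -> R -> R) :
  (forall t, measurable_fun setT (f t)) ->
  measurable_fun setT (fun x => \prod_(t <- s) f t (a t x)).
Proof.
move=> mf; apply: measurable_prod => t _.
exact: (measurableT_comp (mf t)).
Qed.

(** A mixed form made for induction: variables in [s] enter through [f], those in [s'] through
    events. Each step moves one index from [s] to [s'], where independence splits the
    probability. *)
Lemma expectation_indep_prod_indic (f : idx -> R -> R) (m : idx -> R)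
    (s s' : seq idx) (B : idx -> set R) :
  (forall t, measurable_fun setT (f t)) -> (forall t r, 0 <= f t r) ->
  (forall t, valid_idx t -> \int[P]_x (f t (a t x))%:E = (m t)%:E)%E ->
  (forall t, measurable (B t)) ->
  uniq (s ++ s') -> all valid_idx (s ++ s') ->
  (\int[P]_x (\prod_(t <- s) f t (a t x) *
      \1_(\big[setI/setT]_(t <- s') (a t @^-1` B t)) x)%:E =
   (\prod_(t <- s) m t)%:E * P (\big[setI/setT]_(t <- s') (a t @^-1` B t)))%E.
Proof.
move=> mf f0 fm; elim: s s' B => [|t s IH] s' B mB us vs.
  under eq_integral do rewrite big_nil mul1r.
  by rewrite big_nil mul1e integral_indic ?setIT//; exact: measurable_bigI.
move: us vs => /= /andP[tn us] /andP[vt vs].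
have m0 u : valid_idx u -> 0 <= m u.
  by move=> vu; rewrite -lee_fin -fm// integral_ge0// => x _; rewrite lee_fin.
have PB : P (\big[setI/setT]_(u <- s') (a u @^-1` B u)) \is a fin_num.
  by apply: fin_num_measure; exact: measurable_bigI.
rewrite !big_cons.
under eq_integral do rewrite big_cons -mulrA mulrC.
rewrite (@integral_mul_comp (a t) _ (\prod_(u <- s) m u *
    fine (P (\big[setI/setT]_(u <- s') (a u @^-1` B u))))) //.
- rewrite fm// -[in RHS](fineK PB) -!EFinM; congr EFin.
  by rewrite mulrC mulrA.
- apply: measurable_funM; first exact: measurable_prod_comp.
  by apply: measurable_indic; exact: measurable_bigI.
- by move=> x; rewrite mulr_ge0// prodr_ge0.
- rewrite mulr_ge0 ?fine_ge0// big_seq prodr_ge0// => u us'.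
  by apply: m0; apply: (allP vs); rewrite mem_cat us'.
move=> C mC.
(* As [t] is not in [s'], putting [C] at [t] leaves the events indexed by [s'] unchanged. *)
pose B' u := if u == t then C else B u.
have mB' u : measurable (B' u) by rewrite /B'; case: ifP.
have tns' : t \notin s' by move: tn; rewrite mem_cat negb_or => /andP[].
have EB : \big[setI/setT]_(u <- s') (a u @^-1` B' u) =
          \big[setI/setT]_(u <- s') (a u @^-1` B u).
  rewrite big_seq [RHS]big_seq; apply: eq_bigr => u us'.
  by rewrite /B'; case: eqP => // ut; move: tns'; rewrite -ut us'.
have EBt : B' t = C by rewrite /B' eqxx.
have uts : uniq (s ++ t :: s').
  by rewrite (perm_uniq (permEl (perm_catCA s [:: t] s')))/= tn.
have vts : all valid_idx (s ++ t :: s').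
  by move: vs; rewrite !all_cat /= vt => /andP[-> ->].
have := IH (t :: s') B' mB' uts vts.
rewrite big_cons EBt EB => IHt.
under eq_integral do rewrite -mulrA.
transitivity (\int[P]_x (\prod_(j <- s) f j (a j x) *
    \1_(a t @^-1` C `&` \big[setI/setT]_(j <- s') a j @^-1` B j) x)%:E)%E.
  by apply: eq_integral => x _; rewrite indicI/= [(\1_(a t @^-1` C) x * _)]mulrC.
rewrite IHt EFinM fineK// -muleA; congr (_ * _)%E.
have /andP[_ us'] : uniq s && uniq (t :: s').
  by move: uts; rewrite cat_uniq => /and3P[-> _ ->].
have /andP[_ vs'] : all valid_idx s && all valid_idx (t :: s').
  by move: vts; rewrite all_cat.
have := indep us' vs' mB'; rewrite !big_cons EBt EB => ->; rewrite muleC; congr (_ * _)%E.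
move: us' vs' => /= /andP[_ us'] /andP[_ vs'].
by rewrite -EB (indep us' vs' mB').
Qed.

Lemma expectation_indep_prod_ge0 (f : idx -> R -> R) (m : idx -> R) (s : seq idx) :
  (forall t, measurable_fun setT (f t)) -> (forall t r, 0 <= f t r) ->
  (forall t, valid_idx t -> \int[P]_x (f t (a t x))%:E = (m t)%:E)%E ->
  uniq s -> all valid_idx s ->
  (\int[P]_x (\prod_(t <- s) f t (a t x))%:E = (\prod_(t <- s) m t)%:E)%E.
Proof.
move=> mf f0 fm us vs.
have := @expectation_indep_prod_indic f m s [::] (fun=> setT) mf f0 fm.
rewrite cats0 big_nil probability_setT mule1 => <-//.
by apply: eq_integral => x _; rewrite indicT mulr1.
Qed.

(** The nonnegative product formula applied to absolute values gives a finite integral. *)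
Lemma integrable_indep_prod (f : idx -> R -> R) (s : seq idx) :
  (forall t, measurable_fun setT (f t)) ->
  (forall t, valid_idx t -> P.-integrable setT (fun x => (f t (a t x))%:E)) ->
  uniq s -> all valid_idx s ->
  P.-integrable setT (fun x => (\prod_(t <- s) f t (a t x))%:E).
Proof.
move=> mf fi us vs; apply/integrableP; split.
  by apply/measurable_EFinP; exact: measurable_prod_comp.
under eq_integral do rewrite /= normr_prod.
rewrite (@expectation_indep_prod_ge0 (fun t r => `|f t r|)
   (fun t => fine (\int[P]_x `|f t (a t x)|%:E)%E))//.
- exact: ltry.
- by move=> t; apply: measurableT_comp.
- move=> t vt; rewrite fineK//; have /integrableP[_ H] := fi t vt.
  by rewrite ge0_fin_numE// integral_ge0.
Qed.

(** Here [s] holds the indices whose factor may change sign. Induction removes them one at a time by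
    splitting a factor into positive and negative parts. *)
Lemma expectation_indep_prod (f : idx -> R -> R) (s s' : seq idx) :
  (forall t, measurable_fun setT (f t)) ->
  (forall t, valid_idx t -> P.-integrable setT (fun x => (f t (a t x))%:E)) ->
  (forall t r, t \notin s -> 0 <= f t r) ->
  uniq (s ++ s') -> all valid_idx (s ++ s') ->
  (\int[P]_x (\prod_(t <- s ++ s') f t (a t x))%:E =
   (\prod_(t <- s ++ s') fine (\int[P]_x (f t (a t x))%:E))%:E)%E.
Proof.
elim: s s' f => [|t s IH] s' f mf fi f0 us vs.
  apply: expectation_indep_prod_ge0 => //; first by move=> t r; exact: f0.
  by move=> t vt; rewrite fineK//; exact: integrable_fin_num (fi t vt).
(* [fp true] and [fp false] replace the factor at [t] by its positive and its negative part, so [t]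
   may join the nonnegative indices. *)
pose fp b u r := if u == t then (if b then Num.max (f t r) 0 else Num.max (- f t r) 0)
                 else f u r.
have mfp b u : measurable_fun setT (fp b u).
  rewrite /fp; case: eqP => _ //; case: b.
    exact: measurable_funrpos.
  exact: measurable_funrneg.
have fpi b u : valid_idx u -> P.-integrable setT (fun x => (fp b u (a u x))%:E).
  move=> vu; rewrite /fp; case: eqP => [ut|_]; last exact: fi.
  have := fi u vu; rewrite ut => ft; case: b.
    exact: (integrable_funrpos measurableT ft).
  exact: (integrable_funrneg measurableT ft).
move: (us) (vs) => /= /andP[tn us1] /andP[vt vs1].
have tperm : perm_eq (t :: s ++ s') (s ++ t :: s').
  by rewrite perm_sym; apply/permPl; exact: (perm_catCA s [:: t] s').
have uts : uniq (s ++ t :: s') by rewrite -(perm_uniq tperm).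
have vts : all valid_idx (s ++ t :: s') by rewrite -(perm_all _ tperm).
have fp0 b u r : u \notin s -> 0 <= fp b u r.
  move=> uns; rewrite /fp; case: eqVneq => [_|ut].
    by case: b; rewrite le_max lexx orbT.
  by apply: f0; rewrite inE negb_or ut uns.
have IHb b := IH (t :: s') (fp b) (mfp b) (fpi b) (fp0 b) uts vts.
have fpt b r : fp b t r = if b then Num.max (f t r) 0 else Num.max (- f t r) 0.
  by rewrite /fp eqxx.
have fpE r : f t r = fp true t r - fp false t r.
  rewrite !fpt /=; have [f_le0|f_gt0] := leP (f t r) 0.
    by rewrite max_l ?oppr_ge0// sub0r opprK.
  by rewrite max_r ?subr0// oppr_le0 ltW.
have fpn b u r : u \in s ++ s' -> fp b u r = f u r.
  by rewrite /fp; case: eqP => // ->; rewrite (negPf tn).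
have prodfp b x : \prod_(u <- s ++ t :: s') fp b u (a u x) =
    fp b t (a t x) * \prod_(u <- s ++ s') f u (a u x).
  rewrite -(perm_big _ tperm) big_cons; congr (_ * _).
  by rewrite big_seq [RHS]big_seq; apply: eq_bigr => u us2; rewrite fpn.
have prodEfp b : \prod_(u <- s ++ t :: s') fine (\int[P]_x (fp b u (a u x))%:E)%E =
    fine (\int[P]_x (fp b t (a t x))%:E)%E *
    \prod_(u <- s ++ s') fine (\int[P]_x (f u (a u x))%:E)%E.
  rewrite -(perm_big _ tperm) big_cons; congr (_ * _).
  rewrite big_seq [RHS]big_seq; apply: eq_bigr => u us2.
  by congr fine; apply: eq_integral => x _; rewrite fpn.
have -> : (\int[P]_x (\prod_(u <- t :: s ++ s') f u (a u x))%:E =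
   \int[P]_x ((\prod_(u <- s ++ t :: s') fp true u (a u x))%:E -
              (\prod_(u <- s ++ t :: s') fp false u (a u x))%:E))%E.
  by apply: eq_integral => x _; rewrite -EFinB !prodfp big_cons -mulrBl -fpE.
rewrite integralB_EFin//; [|exact: (integrable_indep_prod (mfp _) (fpi _) uts vts)..].
rewrite !IHb -EFinB !prodEfp -mulrBl big_cons; congr (_ * _)%:E.
have fpfin b : (\int[P]_x (fp b t (a t x))%:E)%E \is a fin_num.
  by apply: integrable_fin_num => //; exact: fpi.
rewrite -fineB//.
rewrite -integralB_EFin//; [|exact: (fpi _ _ vt)..].
by congr fine; apply: eq_integral => x _; rewrite -EFinB -fpE.
Qed.

End Independence.

(** * Moments of the trace *)

(** The product is at most the power of its largest factor, which is one of the summands. This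
    bounds mixed moments by absolute moments of single variables. *)
Lemma normr_prod_le_sum (R : realDomainType) (I : eqType) (s : seq I) (F : I -> R) :
  (0 < size s)%N ->
  `|\prod_(i <- s) F i| <= \sum_(i <- s) `|F i| ^+ size s.
Proof.
move=> s0.
have [j js jmax] : exists2 j, j \in s & forall i, i \in s -> `|F i| <= `|F j|.
  elim: s s0 => //= i [|i' s] IH _.
    by exists i; rewrite ?mem_head// => l; rewrite inE => /eqP->.
  have [j js jmax] := IH isT.
  have [ij|ji] := leP `|F i| `|F j|.
    exists j; first by rewrite inE js orbT.
    by move=> l; rewrite inE => /orP[/eqP->//|/jmax].
  exists i; first by rewrite mem_head.
  move=> l; rewrite inE => /orP[/eqP->//|/jmax lj].
  exact: le_trans lj (ltW ji).
rewrite normr_prod; apply: (@le_trans _ _ (`|F j| ^+ size s)).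
  rewrite -[leRHS]mulr1 -[X in _ ^+ X](count_predT s) -iter_mulr -big_const_seq.
  by rewrite big_seq [leRHS]big_seq; apply: ler_prod => i /jmax ->; rewrite normr_ge0.
rewrite (big_rem j js)/= lerDl.
by apply: sumr_ge0 => i _; rewrite exprn_ge0.
Qed.

Section Moments.
Context (d : measure_display) (T : measurableType d) (R : realType)
  (P : probability T R).
Local Notation idx := (nat * nat * nat)%type.
Variable a : idx -> {RV P >-> R}.
Hypothesis indep : mutually_independent P (fun t => (a t : T -> R)).
Local Notation a0 := (a (2, 0, 1)%N).
Hypothesis same : forall t, valid_idx t -> same_law P (a t) a0.
Hypothesis moments : forall p : nat, P.-integrable setT (fun x => (`|a0 x| ^+ p)%:E).
Hypothesis mean0 : ('E_P[a0] = 0)%E.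

Let M p := fine (\int[P]_x (`|a0 x| ^+ p)%:E)%E.

Lemma same_law_distribution_integral t (g : R -> \bar R) : valid_idx t ->
  (\int[distribution P (a t)]_y g y = \int[distribution P a0]_y g y)%E.
Proof.
move=> vt; apply: eq_measure_integral => B mB _.
exact: (same vt mB).
Qed.

Lemma same_law_integral t (g : R -> R) : valid_idx t ->
  measurable_fun setT g -> (forall r, 0 <= g r) ->
  (\int[P]_x (g (a t x))%:E = \int[P]_x (g (a0 x))%:E)%E.
Proof.
move=> vt mg g0.
have mg' : measurable_fun setT (fun r : R => (g r)%:E) by exact/measurable_EFinP.
have g0' r : (0 <= (g r)%:E)%E by rewrite lee_fin.
rewrite -(ge0_integral_distribution (a t) mg' g0').
rewrite -(ge0_integral_distribution a0 mg' g0').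
exact: same_law_distribution_integral.
Qed.

Lemma measurable_exprn_norm p : measurable_fun setT (fun r : R => `|r| ^+ p).
Proof. by apply: measurable_funX; exact: normr_measurable. Qed.

Lemma abs_moment t p : valid_idx t -> (\int[P]_x (`|a t x| ^+ p)%:E = (M p)%:E)%E.
Proof.
move=> vt; rewrite (@same_law_integral t (fun r => `|r| ^+ p) vt)//.
  by rewrite fineK//; apply: integrable_fin_num => //; exact: moments.
exact: measurable_exprn_norm.
Qed.

Lemma integrable_power t p : valid_idx t ->
  P.-integrable setT (fun x => ((a t x) ^+ p)%:E).
Proof.
move=> vt; apply/integrableP; split.
  by apply/measurable_EFinP/measurable_funX.
under eq_integral do rewrite /= normrX.
by rewrite abs_moment// ltry.
Qed.

Lemma integral_entry0 t : valid_idx t -> (\int[P]_x (a t x)%:E = 0)%E.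
Proof.
move=> vt.
have mE : measurable_fun setT (fun r : R => r%:E) by exact/measurable_EFinP.
have it u : valid_idx u -> P.-integrable setT ((fun r : R => r%:E) \o a u).
  by move=> /(integrable_power 1); apply: eq_integrable.
have := integral_distribution mE (it _ vt); rewrite /= => <-.
rewrite (same_law_distribution_integral _ vt) (integral_distribution mE (it _ _))//.
by move: mean0; rewrite unlock.
Qed.

(** Independence concerns distinct indices, so repeated factors are first gathered into powers. *)
Lemma prod_undup_count (s : seq idx) x :
  \prod_(t <- s) a t x = \prod_(t <- undup s) a t x ^+ count_mem t s.
Proof. by rewrite -(big_undup_iterop_count _ s). Qed.

Lemma integrable_prod_entries (s : seq idx) : all valid_idx s ->
  P.-integrable setT (fun x => (\prod_(t <- s) a t x)%:E).
Proof.
move=> vs; under eq_fun do rewrite prod_undup_count.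
apply: (integrable_indep_prod indep (f := fun t r => r ^+ count_mem t s)).
- by move=> t; exact: measurable_funX.
- by move=> t; exact: integrable_power.
- exact: undup_uniq.
- by apply/allP => t; rewrite mem_undup; exact: (allP vs).
Qed.

Lemma expectation_prod_single (s : seq idx) t : all valid_idx s ->
  count_mem t s = 1%N -> (\int[P]_x (\prod_(u <- s) a u x)%:E = 0)%E.
Proof.
move=> vs ct; under eq_integral do rewrite prod_undup_count.
have vu : all valid_idx (undup s).
  by apply/allP => u; rewrite mem_undup; exact: (allP vs).
have ts : t \in s by rewrite -has_pred1 has_count ct.
(* All of [undup s] counts as possibly signed; outside it the exponent is 0 and the factor is the
   constant 1. *)
have := @expectation_indep_prod _ _ _ _ _ indep (fun u r => r ^+ count_mem u s) (undup s) [::].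
rewrite cats0 => ->//.
- rewrite (big_rem t) ?mem_undup//= ct.
  under eq_integral do rewrite expr1.
  by rewrite integral_entry0 ?mul0r//; exact: (allP vs).
- by move=> u; exact: integrable_power.
- by move=> u r; rewrite mem_undup => /count_memPn ->; rewrite expr0.
- exact: undup_uniq.
Qed.

Lemma expectation_prod_le (s : seq idx) : all valid_idx s -> (0 < size s)%N ->
  (\int[P]_x (\prod_(u <- s) a u x)%:E <= ((size s)%:R * M (size s))%:E)%E.
Proof.
move=> vs s0.
apply: (@le_trans _ _ (\int[P]_x (\sum_(u <- s) (`|a u x| ^+ size s)%:E))%E).
  apply: le_integral => //.
  - exact: integrable_prod_entries.
  - under eq_fun do rewrite big_seq.
    apply: integrable_sum => // u us; have vu := allP vs u us.
    apply: eq_integrable (integrable_norm (integrable_power (size s) vu)) => // x _.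
    by rewrite /= normrX.
  - move=> x _; rewrite sumEFin lee_fin.
    by apply: le_trans (normr_prod_le_sum _ s0); exact: ler_norm.
rewrite ge0_integral_sum//.
- rewrite big_seq; under eq_bigr => u us do rewrite abs_moment ?(allP vs)//.
  rewrite -big_seq sumEFin lee_fin.
  by rewrite big_const_seq count_predT iter_addr addr0 mulr_natl.
- by move=> u; apply/measurable_EFinP; apply: (measurableT_comp (measurable_exprn_norm _)).
Qed.

(** The undirected edge under a step, which is also the index of the random variable found at either
    of the two mirrored matrix positions. *)
Definition edge N (e : 'I_N * 'I_N) : idx := (N, minn e.1 e.2, maxn e.1 e.2).

Lemma edge_inj N (e e' : 'I_N * 'I_N) :
  edge e = edge e' -> (e.1 == e'.1) || (e.1 == e'.2).
Proof. by rewrite -!val_eqE => -[] /=; lia. Qed.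

(** * Expected traces of the random matrix as sums over closed walks *)

Variables (k N : nat).

Definition randmx (x : T) : 'M[R]_N := checkerboard k N (fun i j => a (N, i, j) x).

(** A step between congruent indices meets a zero entry. Otherwise no step stays in place, so every
    edge is a valid index. *)
Lemma walk_weight (i : 'I_N) (t : seq 'I_N) :
  (forall x, \prod_(e <- steps i t) randmx x e.1 e.2 = 0) \/
  (all valid_idx (map (@edge N) (steps i t)) /\
   forall x, \prod_(e <- steps i t) randmx x e.1 e.2 =
     \prod_(u <- map (@edge N) (steps i t)) a u x).
Proof.
have [/hasP[e es /eqP ek]|/hasPn nk] :=
    boolP (has (fun e : 'I_N * 'I_N => e.1 %% k == e.2 %% k)%N (steps i t)).
  by left=> x; rewrite (big_rem e es)/= mxE ek eqxx mul0r.
right; split.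
  apply/allP => _ /mapP[e /nk ek ->]; rewrite /edge /=.
  have minmax (p q : nat) : p != q -> (p < N)%N -> (q < N)%N ->
      (minn p q < maxn p q < N)%N by lia.
  by apply: minmax => //; apply: contraNneq ek => ->.
move=> x; rewrite big_map big_seq [RHS]big_seq; apply: eq_bigr => e /nk ek.
by rewrite mxE (negPf ek).
Qed.

Lemma integrable_walk (i : 'I_N) (t : seq 'I_N) :
  P.-integrable setT (fun x => (\prod_(e <- steps i t) randmx x e.1 e.2)%:E).
Proof.
have [W0|[vs WE]] := walk_weight i t.
  by under eq_fun do rewrite W0; exact: integrable0.
by under eq_fun do rewrite WE; exact: integrable_prod_entries.
Qed.

(** An edge used once makes the expectation vanish. If all edges repeat, at most [m] are distinct
    and the walk has at most [m.+1] vertices. The boolean factor keeps this condition for the later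
    count. *)
Lemma expectation_walk_le (i : 'I_N) (t : seq 'I_N) m :
  size t = (2 * m)%N -> (0 < m)%N ->
  (\int[P]_x (\prod_(e <- steps i t) randmx x e.1 e.2)%:E <=
   ((size (undup (i :: t)) <= m.+1)%N%:R * ((2 * m)%:R * M (2 * m)))%:E)%E.
Proof.
move=> st m0.
have M0 p : 0 <= M p.
  by rewrite fine_ge0// integral_ge0// => x _; rewrite lee_fin exprn_ge0.
have [W0|[vs WE]] := walk_weight i t.
  by under eq_integral do rewrite W0; rewrite integral0 lee_fin !mulr_ge0.
under eq_integral do rewrite WE.
set s := map _ _ in vs *.
have ss : size s = (2 * m)%N by rewrite size_map size_steps.
have [/hasP[u us /eqP cu]|/hasPn nc] := boolP (has (fun u => count_mem u s == 1%N) s).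
  by rewrite (expectation_prod_single vs cu) lee_fin !mulr_ge0.
have rep u : u \in s -> (1 < count_mem u s)%N.
  move=> us; have := nc u us; have : (0 < count_mem u s)%N by rewrite -has_count has_pred1.
  by case: (count_mem u s) => [|[|]].
have := size_undup_repeated rep; rewrite ss leq_pmul2l// => su.
have -> : (size (undup (i :: t)) <= m.+1)%N.
  by apply: leq_trans (size_undup_steps _ _ (@edge_inj N)) _; rewrite ltnS.
by rewrite mul1r -ss; apply: expectation_prod_le => //; rewrite ss muln_gt0.
Qed.

Lemma trace_walks x L :
  \tr (randmx x ^+ L) = \sum_(p : 'I_N * L.-tuple 'I_N | last p.1 p.2 == p.1)
    \prod_(e <- steps p.1 p.2) randmx x e.1 e.2.
Proof.
rewrite [RHS]big_mkcond -(pair_bigA _ (fun i t => if last i (tval t) == i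
  then \prod_(e <- steps i t) randmx x e.1 e.2 else 0))/=.
by apply: eq_bigr => i _; rewrite mx_exp_walks big_mkcond.
Qed.

Lemma integrable_trace L :
  P.-integrable setT (fun x => (\tr (randmx x ^+ L))%:E).
Proof.
under eq_fun do rewrite trace_walks -sumEFin.
apply: integrable_sum => [|p _]; [exact: measurableT|exact: integrable_walk].
Qed.

Lemma expectation_trace_le m : (0 < m)%N ->
  (\int[P]_x (\tr (randmx x ^+ (2 * m)))%:E <=
   ((m.+1 ^ (2 * m).+1)%:R * ((2 * m)%:R * M (2 * m)) * N%:R ^+ m.+1)%:E)%E.
Proof.
move=> m0.
have M0 p : 0 <= M p.
  by rewrite fine_ge0// integral_ge0// => x _; rewrite lee_fin exprn_ge0.
under eq_integral do rewrite trace_walks -sumEFin.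
rewrite integral_sum; [|exact: measurableT|by move=> p; exact: integrable_walk].
set c := (2 * m)%:R * M (2 * m).
have c0 : 0 <= c by rewrite mulr_ge0.
apply: (@le_trans _ _ (\sum_(p : 'I_N * (2 * m).-tuple 'I_N | last p.1 p.2 == p.1)
   ((size (undup (p.1 :: p.2)) <= m.+1)%N%:R * c)%:E)%E).
  by apply: lee_sum => p _; apply: expectation_walk_le => //; rewrite size_tuple.
rewrite sumEFin lee_fin.
(* The terms are nonnegative, so the condition that walks close up may be dropped; the count of
   [card_few_values] still gives the power [m.+1] of [N]. *)
apply: (@le_trans _ _ (\sum_(p : 'I_N * (2 * m).-tuple 'I_N)
   ((size (undup (p.1 :: p.2)) <= m.+1)%N%:R * c))).
  rewrite big_mkcond; apply: ler_sum => p _.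
  by case: ifP => // _; rewrite mulr_ge0.
rewrite -mulr_suml mulrAC ler_wpM2r// -natr_sum -natrX -natrM ler_nat.
apply: leq_trans (leq_trans _ (card_few_values 'I_N (2 * m) m)) _; last first.
  by rewrite card_ord.
rewrite -sum1dep_card [leqRHS]big_mkcond /=; apply: leq_sum => p _.
by case: ifP.
Qed.

(** An even power is the square of a symmetric matrix, and its trace is the sum of the squared
    entries of that matrix. *)
Lemma trace_even_ge0 x m : 0 <= \tr (randmx x ^+ (2 * m)).
Proof.
have sym : (randmx x)^T = randmx x.
  by apply/matrixP => i j; rewrite !mxE eq_sym minnC maxnC.
have symm : (randmx x ^+ m)^T = randmx x ^+ m.
  elim: m => [|m IH]; first by rewrite expr0 trmx1.
  by rewrite {1}exprS trmx_mul IH sym exprSr.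
rewrite mul2n -addnn exprD; apply: sumr_ge0 => i _.
rewrite -[X in X * _]symm mxE; apply: sumr_ge0 => j _.
by rewrite mxE -expr2 sqr_ge0.
Qed.

End Moments.

(** * Residue classes and the low-rank part *)

Lemma sum_inv_sqr_le (R : realFieldType) n :
  \sum_(i < n) (i.+1%:R ^- 2 : R) <= 2.
Proof.
case: n => [|n]; first by rewrite big_ord0.
(* The sharper bound is the one that passes through the induction. *)
apply: (@le_trans _ _ (2 - n.+1%:R^-1)); last by rewrite gerBl invr_ge0.
elim: n => [|n IH]; first by rewrite big_ord1 expr1n invr1; lra.
rewrite big_ord_recr /=; apply: le_trans (lerD IH (lexx _)) _.
set y : R := n.+1%:R.
have y0 : 0 < y by rewrite ltr0n.
have -> : n.+2%:R = y + 1 :> R by rewrite -natr1.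
rewrite -subr_ge0.
have -> : 2 - (y + 1)^-1 - (2 - y^-1 + (y + 1) ^- 2) = (y * (y + 1) ^+ 2)^-1.
  by field; apply/andP; split; apply: lt0r_neq0; lra.
by rewrite invr_ge0 mulr_ge0 ?exprn_ge0; lra.
Qed.

Lemma count_residue (k N r : nat) : (r < k)%N ->
  (\sum_(i < N) (i %% k == r) = N %/ k + (r < N %% k))%N.
Proof.
move=> rk; have k0 : (0 < k)%N by apply: leq_ltn_trans rk.
elim: N => [|N IH]; first by rewrite big_ord0 div0n mod0n.
rewrite big_ord_recr /= IH divnS// modnS.
have tk := ltn_pmod N k0.
case: ifP => kN; last by rewrite add0n -addnA ltnS; congr addn; lia.
have -> : (N %% k = k.-1)%N.
  have /dvdnP[c Hc] := kN; have := divn_eq N k.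
  move: tk Hc; set t := (N %% k)%N; set q := (N %/ k)%N => tk Hc HN.
  have Ec : (c = q.+1)%N by nia.
  by move: Hc; rewrite Ec mulSn; lia.
rewrite addnAC [RHS]addnC addnA; lia.
Qed.

Lemma dist_count_residue (k N r : nat) (R : realDomainType) : (r < k)%N ->
  `|k%:R * (\sum_(i < N) (i %% k == r))%:R - N%:R| <= k%:R :> R.
Proof.
move=> rk; rewrite count_residue//.
have := divn_eq N k; have := ltn_pmod N (leq_ltn_trans (leq0n r) rk).
set q := (N %/ k)%N; set t := (N %% k)%N => tk NE.
rewrite [in X in _ - X]NE -natrM ler_norml; apply/andP; split.
  rewrite -subr_ge0 opprK addrAC subr_ge0 -natrD ler_nat.
  by case: (_ < _)%N; nia.
by rewrite lerBlDr -natrD ler_nat; case: (_ < _)%N; nia.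
Qed.

(** The matrix factors through the [k]-dimensional space indexed by residue classes. *)
Lemma rank_Zmat_le (R : fieldType) (k N : nat) : (0 < k)%N ->
  (\rank (k%:R *: Zmat R k N) <= k)%N.
Proof.
move=> k0; apply: leq_trans (mxrankS (scalemx_sub _ (submx_refl _))) _.
pose L : 'M[R]_(N, k) := \matrix_(i, r) ((i %% k == r)%N%:R * (fibF r.+1)%:R).
pose Q : 'M[R]_(k, N) := \matrix_(r, j) (j %% k == r)%N%:R.
have -> : Zmat R k N = L *m Q.
  apply/matrixP => i j; rewrite !mxE.
  rewrite (bigD1 (Ordinal (ltn_pmod i k0)))//= big1 => [|r ri].
    rewrite !mxE /= eqxx mul1r addr0 [(j %% k == _)%N]eq_sym.
    by case: eqP; rewrite ?mulr1 ?mulr0.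
  rewrite !mxE; case: eqP => ir; last by rewrite !mul0r.
  by move: ri; rewrite -val_eqE /= ir eqxx.
exact: leq_trans (mxrankM_maxl _ _) (rank_leq_col _).
Qed.

Definition class_vector (R : nzRingType) (k N r : nat) : 'rV[R]_N :=
  \row_j (j %% k == r)%N%:R.

Lemma class_vector_neq0 (R : nzRingType) k N r :
  (r < k <= N)%N -> class_vector R k N r != 0.
Proof.
move=> /andP[rk kN]; apply/eqP => /rowP/(_ (Ordinal (leq_trans rk kN))).
by rewrite !mxE /= modn_small// eqxx => /eqP; rewrite oner_eq0.
Qed.

(** [Zmat] is constant on the block of each class, so it multiplies the indicator by class size
    times Fibonacci value. The size is only approximately [N / k], whence the later error term. *)
Lemma class_vector_eigen (R : comNzRingType) k N r :
  class_vector R k N r *m (k%:R *: Zmat R k N) =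
  (k%:R * (\sum_(i < N) (i %% k == r))%:R * (fibF r.+1)%:R) *: class_vector R k N r.
Proof.
apply/rowP => j; rewrite -scalemxAr !mxE -!mulrA; congr (_ * _).
rewrite natr_sum mulr_suml; apply: eq_bigr => i _; rewrite !mxE.
case: (eqVneq (i %% k)%N r) => [->|_]; last by rewrite !mul0r.
by rewrite !mul1r eq_sym; case: eqP; rewrite ?mulr1 ?mulr0.
Qed.

(** * Almost sure bounds *)

Section AlmostSure.
Context (d : measure_display) (T : measurableType d) (R : realType)
  (P : probability T R) (k : nat -> nat) (a : nat * nat * nat -> {RV P >-> R}).
Hypothesis indep : mutually_independent P (fun t => (a t : T -> R)).
Hypothesis same : forall t, valid_idx t -> same_law P (a t) (a (2, 0, 1)%N).
Hypothesis moments : forall p : nat,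
  P.-integrable setT (fun x => (`|a (2, 0, 1)%N x| ^+ p)%:E).
Hypothesis mean0 : ('E_P[a (2, 0, 1)%N] = 0)%E.

(* Summing the expectations of [tr (A_N ^ 2m) / N ^ (m + 3) = O(N ^ -2)]
   replaces the usual Markov and Borel-Cantelli argument. *)
Lemma ae_trace_le m : (0 < m)%N ->
  \forall w \near almost_everywhere P, exists C : R, 0 <= C /\
    forall N, (0 < N)%N ->
      \tr (randmx a (k N) N w ^+ (2 * m)) <= C * N%:R ^+ (m + 3).
Proof.
move=> m0.
(* The shift to [n.+1] avoids dividing by a power of zero. *)
pose F n x := (\tr (randmx a (k n.+1) n.+1 x ^+ (2 * m)) * (n.+1%:R ^- (m + 3)))%:E.
have F0 n x : (0 <= F n x)%E.
  by rewrite lee_fin mulr_ge0 ?trace_even_ge0// invr_ge0 exprn_ge0.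
have trI n := integrable_trace indep same moments (k n.+1) n.+1 (2 * m).
have mF n : measurable_fun setT (F n).
  have /measurable_int/measurable_EFinP mtr := trI n.
  by apply/measurable_EFinP/measurable_funM.
pose G x := (\sum_(n <oo) F n x)%E.
have mG : measurable_fun setT G.
  by apply: ge0_emeasurable_sum => n *; [exact: F0|exact: mF].
have G0 x : (0 <= G x)%E by apply: nneseries_ge0 => n _ _; exact: F0.
pose K := ((m.+1 ^ (2 * m).+1)%:R *
  ((2 * m)%:R * fine (\int[P]_x (`|a (2, 0, 1)%N x| ^+ (2 * m))%:E)%E)) : R.
have K0 : 0 <= K.
  rewrite mulr_ge0// mulr_ge0//; apply/fine_ge0/integral_ge0 => x _.
  by rewrite lee_fin exprn_ge0.
have IF n : (\int[P]_x F n x <= (K * n.+1%:R ^- 2)%:E)%E.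
  rewrite /F; under eq_integral do rewrite EFinM.
  rewrite (integralZr measurableT (trI n)).
  have := expectation_trace_le indep same moments mean0 (k n.+1) n.+1 m0.
  rewrite -/K => H.
  apply: (le_trans (lee_wpmul2r _ H)); first by rewrite lee_fin invr_ge0 exprn_ge0.
  rewrite -EFinM lee_fin -mulrA ler_wpM2l//.
  (* The expected trace grows like the power [m.+1]; the two spare powers leave a summable inverse
     square. *)
  rewrite (_ : (m + 3 = m.+1 + 2)%N); last by lia.
  by rewrite exprD invfM mulrA divff ?mul1r// expf_neq0// pnatr_eq0.
have IG : (\int[P]_x G x < +oo)%E.
  rewrite integral_nneseries//.
  apply: (@le_lt_trans _ _ (K * 2)%:E); last exact: ltry.
  apply: lime_le; first by apply: is_cvg_nneseries => n _ _; exact: integral_ge0.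
  apply: nearW => n; rewrite big_mkord.
  apply: (@le_trans _ _ (\sum_(i < n) (K * i.+1%:R ^- 2)%:E)%E).
    by apply: lee_sum => i _; exact: IF.
  by rewrite sumEFin lee_fin -mulr_sumr ler_wpM2l// sum_inv_sqr_le.
have GI : P.-integrable setT G.
  apply/integrableP; split => //.
  by under eq_integral do rewrite gee0_abs//.
apply: filterS (integrable_ae measurableT GI) => w /(_ I) Gfin.
(* Each nonnegative term is at most the full sum, which therefore serves as a constant uniform in
   [N]. *)
exists (fine (G w)); split; first by rewrite fine_ge0.
case=> // n _.
have : (F n w <= G w)%E.
  apply: le_trans (nneseries_lim_ge n.+1 _) => //.
  by rewrite big_mkord big_ord_recr/= leeDr// sume_ge0.
rewrite -{1}(fineK Gfin) lee_fin ler_pdivrMr// exprn_gt0//.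
Qed.

(** The exponents compare because [m + 3 <= 2 * m * (1/2 + eps)]. Using [1 + C] makes the base at
    least 1, so its power dominates [C]. *)
Lemma trace_le_powR (C eps : R) (m N : nat) : 0 <= C -> (0 < m)%N ->
  3 <= 2 * m%:R * eps -> (0 < N)%N ->
  C * N%:R ^+ (m + 3) <= ((1 + C) * N%:R `^ (2^-1 + eps)) ^+ (2 * m).
Proof.
move=> C0 m0 meps N0; rewrite exprMn.
have N1 : 1 <= N%:R :> R by rewrite ler1n.
apply: ler_pM => //.
  apply: (@le_trans _ _ (1 + C)); first by rewrite lerDr.
  by rewrite ler_eXnr ?lerDl// muln_gt0.
rewrite -!powR_mulrn ?powR_ge0// -powRrM ler_powR//.
by rewrite natrD natrM mulrDl; lra.
Qed.

(** * Almost sure location of the eigenvalues of [Mmat] *)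

Hypothesis k_bounds : forall N : nat, (0 < N)%N -> (0 < k N <= N)%N.
Hypothesis k_infty : forall m : nat, \forall N \near \oo, (m <= k N)%N.
Hypothesis k_sqrt : exists C : R,
  \forall N \near \oo, (k N)%:R <= C * Num.sqrt (N%:R).

Let entries N w i j := a (N, i, j) w.

Lemma Mmat_sym N w : (Mmat (k N) N (entries N w))^T = Mmat (k N) N (entries N w).
Proof.
by apply/matrixP => i j; rewrite !mxE eq_sym minnC maxnC; case: eqP => // ->.
Qed.

Variable eps : R.
Hypothesis eps0 : 0 < eps.

Lemma ae_sqn_le :
  \forall w \near almost_everywhere P, exists K : R, 0 <= K /\
    forall N, (0 < N)%N -> forall v,
      sqn (v *m map_mx (real_complex R) (randmx a (k N) N w)) <=
      ((K * N%:R `^ (2^-1 + eps)) ^+ 2)%:C%C * sqn v.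
Proof.
(* The Archimedean bound gives [3 < m * eps], more than the exponent comparison asks; the successor
   makes [m] positive. *)
pose m := (Num.bound (3 / eps)).+1.
have meps : 3 <= 2 * m%:R * eps.
  have : 3 / eps < m%:R.
    apply: lt_trans (archi_boundP _) _; first by rewrite divr_ge0// ltW.
    by rewrite ltr_nat.
  rewrite ltr_pdivrMr// => H.
  have : 0 <= m%:R * eps by rewrite mulr_ge0// ltW.
  by lra.
apply: filterS (ae_trace_le (isT : (0 < m)%N)) => w [C [C0 HC]].
exists (1 + C); split; first by rewrite addr_ge0.
move=> N N0 v; apply: (sym_sqn_le (m := m)) => //.
- by apply/matrixP => i j; rewrite !mxE eq_sym minnC maxnC.
- by rewrite mulr_ge0 ?addr_ge0 ?powR_ge0.
- exact: le_trans (HC N N0) (trace_le_powR C0 _ meps N0).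
Qed.

Lemma ae_bulk_eigenvalues :
  \forall w \near almost_everywhere P, exists C : R, \forall N \near \oo,
    has_eigs_in (Mmat (k N) N (entries N w)) (N - k N)%N
      [set x | `|x| <= C * (N%:R `^ (2^-1 + eps))].
Proof.
apply: filterS ae_sqn_le => w [K [K0 HK]]; exists K.
exists 1%N => // N /= N1.
apply: has_small_eigs; first exact: Mmat_sym.
- by rewrite mulr_ge0 ?powR_ge0.
- exact: HK.
- by have /andP[k0 _] := k_bounds N1; exact: rank_Zmat_le.
Qed.

Lemma ae_blip_eigenvalue n : (0 < n)%N ->
  \forall w \near almost_everywhere P, exists C : R, \forall N \near \oo,
    exists l : R, is_eigenvalue (Mmat (k N) N (entries N w)) l /\
      `|l - N%:R * (fibF n)%:R| <= C * (N%:R `^ (2^-1 + eps)).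
Proof.
case: n => // r _; have [D HD] := k_sqrt.
apply: filterS ae_sqn_le => w [K [K0 HK]].
(* [K] accounts for the perturbation by the random part, the second term for the gap between the
   exact eigenvalue [mu] and [N] times the Fibonacci number. *)
exists (K + `|D| * (fibF r.+1)%:R).
near=> N.
have N0 : (0 < N)%N by near: N; exists 1%N.
(* Only for such [N] is [r] an actual residue, so that its class vector is nonzero. *)
have rk : (r < k N)%N by near: N; exact: k_infty.
have kD : (k N)%:R <= D * Num.sqrt (N%:R) by near: N; exact: HD.
have /andP[k0 kN] := k_bounds N0.
set rho := K * N%:R `^ (2^-1 + eps).
have rho0 : 0 <= rho by rewrite mulr_ge0 ?powR_ge0.
set mu := (k N)%:R * (\sum_(i < N) (i %% k N == r))%:R * (fibF r.+1)%:R : R.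
have [l [l_eig l_mu]] := exists_close_eigenvalue (Mmat_sym N w) rho0 (HK N N0)
  (class_vector_neq0 R (introT andP (conj rk kN))) (class_vector_eigen R (k N) N r).
exists l; split => //; rewrite -/mu in l_mu.
(* The sign of [D] is unknown, hence its absolute value; since [N] is at least 1, the square root is
   below the power [1/2 + eps]. *)
have kpow : (k N)%:R <= `|D| * N%:R `^ (2^-1 + eps).
  apply: (le_trans kD); apply: (@le_trans _ _ (`|D| * Num.sqrt N%:R)).
    by rewrite ler_wpM2r ?sqrtr_ge0// ler_norm.
  by rewrite -powR12_sqrt// ler_wpM2l// ler_powR ?ler1n// lerDl ltW.
rewrite -[l](subrK mu) -addrA; apply: (le_trans (ler_normD _ _)).
rewrite mulrDl; apply: lerD => //.
rewrite /mu -mulrBl normrM normr_nat mulrAC ler_wpM2r//.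
by apply: le_trans kpow; exact: dist_count_residue.
Unshelve. all: by end_near. Qed.

End AlmostSure.

Theorem theoremG6 (R : realType) (d : measure_display) (T : measurableType d)
    (P : probability T R) (k : nat -> nat)
    (a : nat * nat * nat -> {RV P >-> R}) :
  (* k_N : non-decreasing, positive, k_N <= N, k_N -> oo, k_N = O(sqrt N) *)
  (forall N M : nat, (0 < N <= M)%N -> (k N <= k M)%N) ->
  (forall N : nat, (0 < N)%N -> (0 < k N <= N)%N) ->
  (forall m : nat, \forall N \near \oo, (m <= k N)%N) ->
  (exists C : R, \forall N \near \oo, (k N)%:R <= C * Num.sqrt (N%:R)) ->
  (* the entries a_(N,i,j), i < j < N, of A_N: i.i.d. (also across N),
     mean 0, variance 1, finite moments of all orders *)
  mutually_independent P (fun t => (a t : T -> R)) ->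
  (forall t, valid_idx t -> same_law P (a t) (a (2, 0, 1)%N)) ->
  (forall p : nat, P.-integrable setT (fun x => ((`|a (2, 0, 1)%N x| ^+ p)%:E))) ->
  ('E_P[a (2, 0, 1)%N] = 0)%E ->
  ('V_P[a (2, 0, 1)%N] = 1)%E ->
  forall eps : R, 0 < eps ->
    (* a.s. N - k_N eigenvalues of magnitude O(N^(1/2+eps)) *)
    (\forall w \near (almost_everywhere P),
       exists C : R, \forall N \near \oo,
         has_eigs_in (Mmat (k N) N (fun i j => a (N, i, j) w)) (N - k N)%N
           [set x | `|x| <= C * (N%:R `^ (2^-1 + eps))])
    /\
    (* for each n, a.s. an eigenvalue N F_n + O(N^(1/2+eps)) *)
    (forall n : nat, (0 < n)%N ->
     \forall w \near (almost_everywhere P),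
       exists C : R, \forall N \near \oo,
         exists l : R,
           is_eigenvalue (Mmat (k N) N (fun i j => a (N, i, j) w)) l /\
           `|l - N%:R * (fibF n)%:R| <= C * (N%:R `^ (2^-1 + eps))).
Proof.
move=> _ k_bounds k_infty k_sqrt indep same moments mean0 _ eps eps0; split.
  exact: ae_bulk_eigenvalues.
by move=> n n0; exact: ae_blip_eigenvalue.
Qed.
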